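(* Let $\Gamma$ be a quiver, let $(T,f),(T',f')$ be top-representations of $\Gamma$, and let $\mu,\nu:(T,f)\to(T',f')$ be morphisms with $\mu\simeq^t\nu$. Then $S^\Gamma(\mu)\simeq^tS^\Gamma(\nu):S^\Gamma(T,f)\to S^\Gamma(T',f')$, and therefore $H_n(\mu)=H_n(\nu)$ for all $n\ge0$.
   Context: A quiver $\Gamma=(\Gamma_0,\Gamma_1)$ is an oriented graph. A top-representation $(T,f)$ of $\Gamma$ is a family of topological spaces $T(i)$, $i\in\Gamma_0$, with a continuous map $f_\alpha:T(i)\to T(j)$ for each arrow $\alpha:i\to j$; a morphism $\mu:(T,f)\to(T',f')$ is a family of continuous maps $\mu_i:T(i)\to T'(i)$ with $\mu_jf_\alpha=f'_\alpha\mu_i$ for each arrow $\alpha:i\to j$. $\mathbf C\text{-}\mathbf{Rep}\,\Gamma$ is defined in the same way with chain complexes of abelian groups and chain maps in place of spaces and continuous maps. Homotopy of top-representations: $\mu\simeq^t\nu$ means that there are homotopies $H_i:T(i)\times I\to T'(i)$, $I=[0,1]$, from $\mu_i$ to $\nu_i$ for each $i\in\Gamma_0$, such that $f'_\alpha H_i=H_j(f_\alpha\times1)$ for each arrow $\alpha:i\to j$. Homotopy in $\mathbf C\text{-}\mathbf{Rep}\,\Gamma$: for morphisms $a,b:(A,f)\to(B,g)$, $a\simeq^tb$ means that for each $i\in\Gamma_0$ there is a chain homotopy $F_i$ between $a_i$ and $b_i$, with components $(F_i)_n:A(i)_n\to B(i)_{n+1}$, such that $(g_\alpha)_{n+1}(F_i)_n=(F_j)_n(f_\alpha)_n$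 for all $n$ and each arrow $\alpha:i\to j$. $S(X)$ is the singular chain complex of $X$ (with $S_{-1}(X)=0$). The functor $S^\Gamma$ from top-representations to $\mathbf C\text{-}\mathbf{Rep}\,\Gamma$ applies the functor $S$ at each vertex, arrow and component of a morphism. For $(C,g)\in\mathbf C\text{-}\mathbf{Rep}\,\Gamma$, $\lim^{\Gamma,\bullet}(C,g)$ is the subcomplex of $\prod_{i}C(i)$ with degree $n$ part $\{(x_i): x_i\in C(i)_n,\ (g_\alpha)_n(x_i)=x_j\text{ for each arrow }\alpha:i\to j\}$; it is functorial componentwise. Finally $H_n(T,f)=H_n(\lim^{\Gamma,\bullet}(S^\Gamma(T,f)))$ and $H_n(\mu)=H_n(\lim^{\Gamma,\bullet}(S^\Gamma(\mu)))$ for $n\ge0$. *)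

(* Defs.v *)
From HB Require Import structures.
(* First, so that its [lift] does not shadow [fintype.lift]. *)
From mathcomp Require Import freeg.
From mathcomp Require Import all_boot all_order all_algebra.
From mathcomp Require Import all_classical all_reals topology normedtype.
From mathcomp Require Import zify.

Set Implicit Arguments.
Unset Strict Implicit.
Unset Printing Implicit Defensive.

Import Order.TTheory GRing.Theory Num.Theory.
Import numFieldNormedType.Exports.

Local Open Scope classical_set_scope.
Local Open Scope ring_scope.
Local Open Scope quotient_scope.

Record quiver := Quiver {
  vertex : Type;
  arrow : vertex -> vertex -> Type }.

Record topRep (Q : quiver) := TopRep {
  tspace : vertex Q -> topologicalType;
  tmap : forall i j, arrow i j -> continuousType (tspace i) (tspace j) }.

Record topRepHom (Q : quiver) (T T' : topRep Q) := TopRepHom {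
  thom : forall i, continuousType (tspace T i) (tspace T' i);
  thom_comm : forall i j (a : arrow i j) (x : tspace T i),
    thom j (tmap T a x) = tmap T' a (thom i x) }.

Definition unit_interval (R : realType) : set R := [set t | 0 <= t <= 1].
Arguments unit_interval R : clear implicits.

Fact unit_interval0_subproof (R : realType) : 0 \in unit_interval R.
Proof. by rewrite inE /unit_interval/= lexx ler01. Qed.

Fact unit_interval1_subproof (R : realType) : 1 \in unit_interval R.
Proof. by rewrite inE /unit_interval/= lexx ler01. Qed.

Definition unit_interval0 (R : realType) : unit_interval R :=
  exist _ 0 (unit_interval0_subproof R).

Definition unit_interval1 (R : realType) : unit_interval R :=
  exist _ 1 (unit_interval1_subproof R).

Definition is_homotopy (R : realType) (X Y : topologicalType)
    (f g : continuousType X Y)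
    (H : continuousType (X * unit_interval R)%type Y) : Prop :=
  forall x, H (x, unit_interval0 R) = f x /\ H (x, unit_interval1 R) = g x.

Definition top_homotopic (R : realType) (Q : quiver) (T T' : topRep Q)
    (mu nu : topRepHom T T') : Prop :=
  exists H : forall i,
      continuousType (tspace T i * unit_interval R)%type (tspace T' i),
    (forall i, is_homotopy (thom mu i) (thom nu i) (H i)) /\
    (forall i j (a : arrow i j) (x : tspace T i) (t : unit_interval R),
      tmap T' a (H i (x, t)) = H j (tmap T a x, t)).

(* Chain complexes are graded by the integers.  The degree n + 1 is written
   [1 + n], which reduces to a constructor when n does; [bd C n] is the
   differential leaving degree 1 + n. *)
Record chainComplex := ChainComplex {
  chain :> int -> zmodType;
  bd : forall n, {additive chain (1 + n) -> chain n};
  bdK : forall n (x : chain (1 + (1 + n))), bd n (bd (1 + n) x) = 0 }.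

Record chainMap (A B : chainComplex) := ChainMap {
  cmap :> forall n, {additive A n -> B n};
  cmap_bd : forall n (x : A (1 + n)),
    bd B n (cmap (1 + n) x) = cmap n (bd A n x) }.

(* The equation in degree 1 + n, for all integers n, covers every degree. *)
Definition is_chain_homotopy (A B : chainComplex) (a b : chainMap A B)
    (F : forall n, {additive A n -> B (1 + n)%R}) : Prop :=
  forall n (x : A (1 + n)),
    bd B (1 + n) (F (1 + n) x) + F n (bd A n x) = b (1 + n) x - a (1 + n) x.

Record chainRep (Q : quiver) := ChainRep {
  ccomplex :> vertex Q -> chainComplex;
  carrow : forall i j, arrow i j -> chainMap (ccomplex i) (ccomplex j) }.

Record chainRepHom (Q : quiver) (A B : chainRep Q) := ChainRepHom {
  chom : forall i, chainMap (A i) (B i);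
  chom_comm : forall i j (a : arrow i j) n (x : A i n),
    chom j n (carrow A a n x) = carrow B a n (chom i n x) }.

Definition chain_homotopic (Q : quiver) (A B : chainRep Q)
    (a b : chainRepHom A B) : Prop :=
  exists F : forall i n, {additive A i n -> B i (1 + n)%R},
    (forall i, is_chain_homotopy (chom a i) (chom b i) (F i)) /\
    (forall i j (al : arrow i j) n (x : A i n),
      carrow B al (1 + n) (F i n x) = F j n (carrow A al n x)).

Section StandardSimplex.
Variable R : realType.

Definition simplex (n : nat) : set 'rV[R]_n.+1 :=
  [set x | (forall i, 0 <= x 0 i) /\ \sum_i x 0 i = 1].
Arguments simplex n : clear implicits.

(* The affine map of standard simplices sending the vertex l to phi l. *)
Section VertexMap.
Variables (m n : nat) (phi : 'I_m.+1 -> 'I_n.+1).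

Definition vertex_map_row (x : 'rV[R]_m.+1) : 'rV[R]_n.+1 :=
  \row_k \sum_(l | phi l == k) x 0 l.

Lemma vertex_map_simplex (x : simplex m) :
  vertex_map_row (set_val x) \in simplex n.
Proof.
have [x0 x1] : simplex m (set_val x) by apply: set_valP.
rewrite inE; split=> [k|].
  by rewrite mxE; apply: sumr_ge0 => l _; apply: x0.
rewrite -x1 (partition_big phi predT)//=.
by apply: eq_bigr => k _; rewrite mxE.
Qed.

Definition vertex_map (x : simplex m) : simplex n :=
  exist _ (vertex_map_row (set_val x)) (vertex_map_simplex x).

Lemma vertex_map_row_continuous : continuous vertex_map_row.
Proof.
move=> x U [P nP PU].
have cP i j : \forall y \near x, P i j (vertex_map_row y i j).
  have ci : continuous (fun y => vertex_map_row y i j).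
    under eq_fun do rewrite mxE.
    apply: continuous_big => [|l _]; first exact: add_continuous.
    exact: coord_continuous.
  by apply: ci; apply: nP.
have : \forall y \near x, forall i j, P i j (vertex_map_row y i j).
  exact: (filter_forall _ (fun i => filter_forall _ (cP i))).
by apply: filterS => y; exact: PU.
Qed.

Lemma vertex_map_continuous : continuous vertex_map.
Proof.
apply: continuous_comp_initial.
suff : continuous (vertex_map_row \o set_val : simplex m -> 'rV[R]_n.+1) by [].
move=> x; apply: continuous_comp; last exact: vertex_map_row_continuous.
exact: initial_continuous.
Qed.

HB.instance Definition _ :=
  isContinuous.Build (simplex m) (simplex n) vertex_map vertex_map_continuous.

End VertexMap.

Lemma vertex_map_comp (m n p : nat) (psi : 'I_n.+1 -> 'I_p.+1)
    (phi : 'I_m.+1 -> 'I_n.+1) x :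
  vertex_map psi (vertex_map phi x) = vertex_map (psi \o phi) x.
Proof.
apply/val_inj/rowP => k; rewrite !mxE.
rewrite [RHS](partition_big phi (fun l => psi l == k))//=.
apply: eq_bigr => l /eqP psil; rewrite mxE; apply: eq_bigl => j.
by case: eqVneq => [->|]; rewrite ?andbF// psil eqxx.
Qed.

End StandardSimplex.
Arguments simplex R n : clear implicits.
Arguments vertex_map R {m n} phi x.

Section FreegMap.
Variables (K : choiceType) (M : lmodType int) (f : K -> M).

HB.instance Definition _ :=
  GRing.isZmodMorphism.Build {freeg K} M (fglift f) (lift_is_additive f).

Lemma fglift1 k : fglift f << k >> = f k.
Proof. by rewrite liftU scale1r. Qed.

End FreegMap.

Lemma freeg_ext (K : choiceType) (V : zmodType)
    (f g : {additive {freeg K} -> V}) :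
  (forall k, f << k >> = g << k >>) -> f =1 g.
Proof.
move=> fg x; rewrite -[x]freeg_sumE !raddf_sum; apply: eq_bigr => k _.
suff -> : << coeff k x *g k >> = << k >> *~ coeff k x by rewrite !raddfMz fg.
by rewrite freegU_mulz intz.
Qed.

Section SingularComplex.
Variable R : realType.

Definition singular_simplex (X : topologicalType) (n : nat) : choiceType :=
  continuousType (simplex R n) X.

(* 'rV[int]_0 is the zero group. *)
Definition singular_chain (X : topologicalType) (n : int) : zmodType :=
  match n with
  | Posz k => {freeg (singular_simplex X k)}
  | Negz _ => 'rV[int]_0
  end.

Definition singular_face (X : topologicalType) (n : nat)
    (s : singular_simplex X n.+1) (i : 'I_n.+2) : singular_simplex X n :=
  s \o vertex_map R (lift i).

Definition singular_bd_pos (X : topologicalType) (n : nat) :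
    {additive singular_chain X n.+1 -> singular_chain X n} :=
  fglift (fun s : singular_simplex X n.+1 =>
    \sum_(i < n.+2) (-1) ^+ i *: << singular_face s i >>).

Definition singular_bd (X : topologicalType) (n : int) :
    {additive singular_chain X (1 + n) -> singular_chain X n} :=
  match n with
  | Posz k => singular_bd_pos X k
  | Negz _ => \0
  end.

Lemma singular_bd_posE (X : topologicalType) (n : nat)
    (s : singular_simplex X n.+1) :
  singular_bd_pos X n << s >> =
  \sum_(i < n.+2) (-1) ^+ i *: << singular_face s i >>.
Proof. exact: fglift1. Qed.

Lemma lift_lift (n : nat) (i : 'I_n.+3) (j : 'I_n.+2) (l : 'I_n.+1) :
  (j < i)%N ->
  lift i (lift j l) =
  lift (inord j) (lift (inord i.-1) l).
Proof.
move=> ji; apply: val_inj; rewrite /= !inordK; first 1 last.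
- by case: (i : nat) ji (ltn_ord i).
- by rewrite (ltn_trans ji).
rewrite /bump; case: i j l ji => [i /= _] [j /= _] [l /= _] ji.
lia.
Qed.

Lemma singular_face_face (X : topologicalType) (n : nat)
    (s : singular_simplex X n.+2) (i : 'I_n.+3) (j : 'I_n.+2) :
  (j < i)%N ->
  singular_face (singular_face s i) j =
  singular_face (singular_face s (inord j)) (inord i.-1).
Proof.
move=> ji; apply/continuousEP => x /=; congr (s _).
rewrite !vertex_map_comp; congr vertex_map; apply/funext => l.
exact: lift_lift.
Qed.

Lemma singular_bdK (X : topologicalType) (n : int)
    (x : singular_chain X (1 + (1 + n))) :
  singular_bd X n (singular_bd X (1 + n) x) = 0.
Proof.
case: n x => [n|n] x //=.
pose dd : {additive _ -> _} := singular_bd_pos X n \o singular_bd_pos X n.+1.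
suff : dd =1 \0 by apply.
apply: freeg_ext => s /=.
rewrite singular_bd_posE raddf_sum/=.
transitivity (\sum_(i < n.+3) \sum_(j < n.+2)
    (-1) ^+ (i + j) *: << singular_face (singular_face s i) j >> :
    {freeg (singular_simplex X n)}).
  apply: eq_bigr => i _; rewrite (raddfZsign (singular_bd_pos X n)).
  rewrite singular_bd_posE scaler_sumr; apply: eq_bigr => j _.
  by rewrite scalerA exprD.
rewrite pair_bigA/= (bigID (fun p : 'I_n.+3 * 'I_n.+2 => p.2 < p.1)%N)/=.
apply/eqP; rewrite addr_eq0 -sumrN; apply/eqP.
rewrite [RHS](reindex_onto
  (fun p : 'I_n.+3 * 'I_n.+2 => (inord p.2, inord p.1.-1) : 'I_n.+3 * 'I_n.+2)
  (fun p : 'I_n.+3 * 'I_n.+2 =>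
     (inord p.2.+1, inord p.1) : 'I_n.+3 * 'I_n.+2)) /=; last first.
  move=> [i j] /= ij; have := ltn_ord j => jn.
  by congr pair; apply: val_inj; rewrite /= ?inordK//=; lia.
apply: eq_big => [[i j]/=|[i j]/= ji].
  have := ltn_ord i; have := ltn_ord j => jn iN.
  rewrite xpair_eqE -!val_eqE /=.
  case: (ltnP j i) => ji; rewrite ?inordK//=; lia.
have := ltn_ord i; have := ltn_ord j => jn iN.
rewrite (singular_face_face s ji) !inordK; [|lia|lia].
rewrite -scaleNr; congr (_ *: _).
have -> : (i + j)%N = (j + i.-1).+1 by lia.
by rewrite exprS mulN1r.
Qed.

Definition singular_complex (X : topologicalType) : chainComplex :=
  ChainComplex (@singular_bdK X).

Section SingularMap.
Variables (X Y : topologicalType) (f : continuousType X Y).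

Definition singular_cmap_pos (n : nat) :
    {additive singular_chain X n -> singular_chain Y n} :=
  fglift (fun s : singular_simplex X n =>
    << (f \o s : singular_simplex Y n) >>).

Lemma singular_cmap_posE (n : nat) (s : singular_simplex X n) :
  singular_cmap_pos n << s >> = << (f \o s : singular_simplex Y n) >>.
Proof. exact: fglift1. Qed.

Definition singular_cmap (n : int) :
    {additive singular_complex X n -> singular_complex Y n} :=
  match n with
  | Posz k => singular_cmap_pos k
  | Negz _ => \0
  end.

Lemma singular_cmap_bd (n : int) (x : singular_complex X (1 + n)) :
  bd (singular_complex Y) n (singular_cmap (1 + n) x) =
  singular_cmap n (bd (singular_complex X) n x).
Proof.
case: n x => [n|n] x //=.
pose l : {additive _ -> _} := singular_bd_pos Y n \o singular_cmap_pos n.+1.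
pose r : {additive _ -> _} := singular_cmap_pos n \o singular_bd_pos X n.
suff : l =1 r by apply.
apply: freeg_ext => s /=.
rewrite singular_cmap_posE !singular_bd_posE raddf_sum.
apply: eq_bigr => i _; rewrite (raddfZsign (singular_cmap_pos n)).
rewrite singular_cmap_posE; congr (_ *: << _ >>).
exact/continuousEP.
Qed.

Definition singular_map : chainMap (singular_complex X) (singular_complex Y) :=
  ChainMap singular_cmap_bd.

End SingularMap.

Lemma singular_map_comp (X Y Z : topologicalType) (g : continuousType Y Z)
    (f : continuousType X Y) (n : int) (x : singular_complex X n) :
  singular_map g n (singular_map f n x) =
  singular_map (g \o f : continuousType X Z) n x.
Proof.
case: n x => [n|n] x //=.
pose l : {additive _ -> _} := singular_cmap_pos g n \o singular_cmap_pos f n.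
suff : l =1 singular_cmap_pos (g \o f : continuousType X Z) n by apply.
apply: freeg_ext => s /=; rewrite !singular_cmap_posE; congr (<< _ >>).
exact/continuousEP.
Qed.

End SingularComplex.

Section SingularRep.
Variables (R : realType) (Q : quiver).

Definition singular_rep (T : topRep Q) : chainRep Q :=
  @ChainRep Q (fun i => singular_complex R (tspace T i))
    (fun i j a => singular_map R (tmap T a)).

Lemma singular_rep_hom_comm (T T' : topRep Q) (mu : topRepHom T T')
    i j (a : arrow i j) n (x : singular_rep T i n) :
  singular_map R (thom mu j) n (carrow (singular_rep T) a n x) =
  carrow (singular_rep T') a n (singular_map R (thom mu i) n x).
Proof.
rewrite /= !singular_map_comp; congr (singular_map _ _ _ _).
apply/continuousEP => y; exact: thom_comm.
Qed.

Definition singular_rep_hom (T T' : topRep Q) (mu : topRepHom T T') :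
    chainRepHom (singular_rep T) (singular_rep T') :=
  @ChainRepHom Q (singular_rep T) (singular_rep T')
    (fun i => singular_map R (thom mu i))
    (singular_rep_hom_comm mu).

End SingularRep.

Definition dprod (I : Type) (M : I -> zmodType) := forall i, M i.

Section DProd.
Variables (I : Type) (M : I -> zmodType).
Implicit Types x y z : dprod M.

HB.instance Definition _ := gen_eqMixin (dprod M).
HB.instance Definition _ := gen_choiceMixin (dprod M).

Definition dprod0 : dprod M := fun=> 0.
Definition dprod_opp x : dprod M := fun i => - x i.
Definition dprod_add x y : dprod M := fun i => x i + y i.

Fact dprod_addA : associative dprod_add.
Proof. by move=> x y z; apply: functional_extensionality_dep => i; exact: addrA. Qed.

Fact dprod_addC : commutative dprod_add.
Proof. by move=> x y; apply: functional_extensionality_dep => i; exact: addrC. Qed.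

Fact dprod_add0 : left_id dprod0 dprod_add.
Proof. by move=> x; apply: functional_extensionality_dep => i; exact: add0r. Qed.

Fact dprod_addN : left_inverse dprod0 dprod_opp dprod_add.
Proof. by move=> x; apply: functional_extensionality_dep => i; exact: addNr. Qed.

HB.instance Definition _ := GRing.isZmodule.Build (dprod M)
  dprod_addA dprod_addC dprod_add0 dprod_addN.

End DProd.

Section Limit.
Variable Q : quiver.

Section LimitComplex.
Variable C : chainRep Q.

Definition compatible (n : int) : {pred dprod (fun i => C i n)} :=
  fun x => `[< forall i j (a : arrow i j), carrow C a n (x i) = x j >].
Arguments compatible n : clear implicits.

Fact compatible_zmod_closed n : zmod_closed (compatible n).
Proof.
split=> [|x y /asboolP cx /asboolP cy]; apply/asboolP => i j a.
  exact: raddf0.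
by rewrite raddfB cx cy.
Qed.

HB.instance Definition _ n :=
  GRing.isZmodClosed.Build _ (compatible n) (compatible_zmod_closed n).

Record limit_chain (n : int) := LimitChain {
  limit_val : dprod (fun i => C i n);
  limit_valP : limit_val \in compatible n }.

HB.instance Definition _ n := [isSub for @limit_val n].
HB.instance Definition _ n := [Choice of limit_chain n by <:].
HB.instance Definition _ n := [SubChoice_isSubZmodule of limit_chain n by <:].

Fact limit_bd_subproof n (x : limit_chain (1 + n)) :
  (fun i => bd (C i) n (limit_val x i)) \in compatible n.
Proof.
apply/asboolP => i j a; rewrite -cmap_bd; congr (bd _ _ _).
by have /asboolP := limit_valP x; apply.
Qed.

Definition limit_bd_fun n (x : limit_chain (1 + n)) : limit_chain n :=
  LimitChain (limit_bd_subproof x).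

Fact limit_bd_is_zmod_morphism n : zmod_morphism (@limit_bd_fun n).
Proof.
move=> x y; apply/val_inj/functional_extensionality_dep => i.
exact: raddfB.
Qed.

HB.instance Definition _ n := GRing.isZmodMorphism.Build
  (limit_chain (1 + n)) (limit_chain n) (@limit_bd_fun n)
  (@limit_bd_is_zmod_morphism n).

Fact limit_bdK n (x : limit_chain (1 + (1 + n))) :
  limit_bd_fun (limit_bd_fun x) = 0.
Proof. by apply/val_inj/functional_extensionality_dep => i; exact: bdK. Qed.

Definition limit : chainComplex :=
  @ChainComplex limit_chain (fun n => @limit_bd_fun n) limit_bdK.

End LimitComplex.
Arguments compatible C n : clear implicits.
Arguments limit_chain C n : clear implicits.

Section LimitMap.
Variables (A B : chainRep Q) (f : chainRepHom A B).

Fact limit_map_subproof n (x : limit_chain A n) :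
  (fun i => chom f i n (limit_val x i)) \in compatible B n.
Proof.
apply/asboolP => i j a; rewrite -chom_comm; congr (chom f j n _).
by have /asboolP := limit_valP x; apply.
Qed.

Definition limit_map_fun n (x : limit A n) : limit B n :=
  LimitChain (limit_map_subproof x).

Fact limit_map_is_zmod_morphism n : zmod_morphism (@limit_map_fun n).
Proof.
move=> x y; apply/val_inj/functional_extensionality_dep => i.
exact: raddfB.
Qed.

HB.instance Definition _ n := GRing.isZmodMorphism.Build
  (limit A n) (limit B n) (@limit_map_fun n) (@limit_map_is_zmod_morphism n).

Fact limit_map_bd n (x : limit A (1 + n)) :
  bd (limit B) n (limit_map_fun x) = limit_map_fun (bd (limit A) n x).
Proof. by apply/val_inj/functional_extensionality_dep => i; exact: cmap_bd. Qed.

Definition limit_map : chainMap (limit A) (limit B) :=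
  @ChainMap _ _ (fun n => @limit_map_fun n) limit_map_bd.

End LimitMap.
End Limit.
Arguments compatible {Q} C n.
Arguments limit_chain {Q} C n.

Section HomologyGroup.
Variables (C : chainComplex) (n : int).

(* The differential leaving degree n, obtained by transport along
   n = 1 + (n - 1); see bd_from1. *)
Definition bd_from (x : C n) : C (n - 1) :=
  bd C (n - 1) (ecast m (C m) (esym (subrKC 1 n)) x).

Fact bd_from_is_zmod_morphism : zmod_morphism bd_from.
Proof.
move=> x y; rewrite /bd_from -raddfB; congr (bd _ _ _).
by case: _ / (esym _).
Qed.

HB.instance Definition _ :=
  GRing.isZmodMorphism.Build (C n) (C (n - 1)) bd_from bd_from_is_zmod_morphism.

Definition is_cycle : {pred C n} := fun x => bd_from x == 0.

Fact is_cycle_zmod_closed : zmod_closed is_cycle.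
Proof.
split=> [|x y /eqP cx /eqP cy]; apply/eqP; first exact: raddf0.
by rewrite raddfB /= cx cy subrr.
Qed.

HB.instance Definition _ :=
  GRing.isZmodClosed.Build (C n) is_cycle is_cycle_zmod_closed.

Record cycles := Cycle {
  cycle_val :> C n;
  cycle_valP : cycle_val \in is_cycle }.

HB.instance Definition _ := [isSub for cycle_val].
HB.instance Definition _ := [Choice of cycles by <:].
HB.instance Definition _ := [SubChoice_isSubZmodule of cycles by <:].

Definition is_boundary : {pred cycles} :=
  fun z => `[< exists y : C (1 + n), bd C n y = cycle_val z >].

Fact is_boundary_zmod_closed : zmod_closed is_boundary.
Proof.
split=> [|u v /asboolP[x xu] /asboolP[y yv]]; apply/asboolP.
  by exists 0; exact: raddf0.
by exists (x - y); rewrite raddfB xu yv.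
Qed.

HB.instance Definition _ :=
  GRing.isZmodClosed.Build cycles is_boundary is_boundary_zmod_closed.

Definition homology : zmodType := Quotient.quot (is_boundary : zmodClosed _).

End HomologyGroup.
Arguments bd_from {C n} x.
Arguments is_cycle {C n} x.
Arguments cycles C n : clear implicits.
Arguments is_boundary {C n} z.

Lemma bd_from1 (C : chainComplex) (n : int) (x : C (1 + n)) :
  (bd_from x == 0) = (bd C n x == 0).
Proof.
rewrite /bd_from; move: (1 + n - 1) (esym _) => m e.
by have mn : n = m := @addrI int 1 n m e; subst m; rewrite eq_axiomK.
Qed.

Section HomologyMap.
Variables (A B : chainComplex) (f : chainMap A B) (n : int).

Fact bd_from_cmap (x : A n) : bd_from (f n x) = f (n - 1) (bd_from x).
Proof. by rewrite /bd_from -cmap_bd; congr (bd _ _ _); case: _ / (esym _). Qed.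

Fact cycle_map_subproof (z : cycles A n) : f n (cycle_val z) \in is_cycle.
Proof. by apply/eqP; rewrite bd_from_cmap (eqP (cycle_valP z)) raddf0. Qed.

Definition cycle_map (z : cycles A n) : cycles B n :=
  Cycle (cycle_map_subproof z).

Definition homology_map (h : homology A n) : homology B n :=
  \pi_(homology B n) (cycle_map (repr h)).

Lemma homology_map_pi (z : cycles A n) :
  homology_map (\pi_(homology A n) z) = \pi_(homology B n) (cycle_map z).
Proof.
apply/eqP; rewrite -Quotient.idealrBE; apply/asboolP => /=.
have /asboolP[y yE] : repr (\pi_(homology A n) z) - z \in is_boundary.
  by rewrite Quotient.idealrBE reprK.
by exists (f (1 + n) y); rewrite cmap_bd yE !raddfB.
Qed.

Fact homology_map_is_zmod_morphism : zmod_morphism homology_map.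
Proof.
elim/quotW => x; elim/quotW => y; rewrite -raddfB !homology_map_pi.
rewrite -raddfB; congr (\pi _); apply/val_inj; exact: raddfB.
Qed.

HB.instance Definition _ := GRing.isZmodMorphism.Build
  (homology A n) (homology B n) homology_map homology_map_is_zmod_morphism.

End HomologyMap.
Arguments homology_map {A B} f n h.

Definition quiver_homology (R : realType) (Q : quiver) (n : nat)
    (T : topRep Q) : zmodType :=
  homology (limit (singular_rep R T)) n.

Definition quiver_homology_map (R : realType) (Q : quiver) (n : nat)
    (T T' : topRep Q) (mu : topRepHom T T') :
    {additive quiver_homology R n T -> quiver_homology R n T'} :=
  homology_map (limit_map (singular_rep_hom R mu)) n.

(* Main.v *)
Require Import Defs.
From HB Require Import structures.
From mathcomp Require Import freeg.
From mathcomp Require Import all_boot all_order all_algebra.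
From mathcomp Require Import all_classical all_reals topology normedtype.
From mathcomp Require Import zify.

(** A homotopy H from f to g induces the classical prism operator
    P : S_n(X) -> S_(n+1)(Y).  The prism over a singular simplex s is
    triangulated by the n + 1 simplices with vertices
    v_0, ..., v_i, w_i, ..., w_n, where v_k and w_k are the copies of the
    vertex k at times 0 and 1; the i-th one is
    x |-> H (s (sigma_i x), x_(i+1) + ... + x_(n+1)), sigma_i being the
    degeneracy that identifies the vertices i and i + 1.  P is the alternating
    sum of these simplices.

    Simplices of the shape x |-> H (s (phi x), sum of the x_l with l >= c), for
    phi a map of vertices and c a threshold, are stable under taking faces
    (prism_face), and such a simplex built on a face of s is also one built on
    s itself (prism_of_face).
    So all the identities between prism simplices reduce to identities between
    vertex maps and thresholds.  In the boundary of P s, the faces i and i + 1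
    of the i-th simplex telescope to g s - f s (bd_prism_op), and the other
    faces make up - P (bd s) (prism_op_bd); hence P is a chain homotopy.

    The formula for P involves only composition with H, so that a family of
    homotopies commuting with the arrows of the quiver gives operators
    commuting with the arrows (prism_op_natural): this is the first claim.
    Moreover operators commuting with the arrows preserve compatible families,
    so they restrict to a chain homotopy between the maps induced on the limit
    complexes (limit_chain_homotopy), and chain homotopic maps agree on
    homology: this is the second claim. *)

Set Implicit Arguments.
Unset Strict Implicit.
Unset Printing Implicit Defensive.

Import Order.TTheory GRing.Theory Num.Theory.
Import numFieldNormedType.Exports.

Local Open Scope classical_set_scope.
Local Open Scope ring_scope.
Local Open Scope quotient_scope.

(** Additive maps are bundled with a proof, which is irrelevant; this turns
    pointwise equality on homology into equality of the induced maps. *)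
Lemma additive_ext (U V : zmodType) (f g : {additive U -> V}) :
  f =1 g -> f = g.
Proof.
case: f g => [f [[fP]]] [g [[gP]]] /= /funext fg; subst g.
by rewrite (Prop_irrelevance fP gP).
Qed.

(** * The time coordinate on a simplex *)

Section TailWeight.
Variables (R : realType) (m c : nat).

(** The affine function with value 0 at the vertices below c and 1 at the
    others: the time at which each point of a simplex of the prism lies. *)
Definition tail_sum (x : 'rV[R]_m.+1) : R := \sum_(l < m.+1 | (c <= l)%N) x 0 l.

Fact tail_weight_subproof (x : simplex R m) :
  tail_sum (set_val x) \in unit_interval R.
Proof.
have [x0 x1] : simplex R m (set_val x) by apply: set_valP.
rewrite inE /unit_interval/=; apply/andP; split; first exact: sumr_ge0.
rewrite -x1 [leRHS](bigID (fun l : 'I_m.+1 => c <= l)%N)/= lerDl.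
exact: sumr_ge0.
Qed.

Definition tail_weight (x : simplex R m) : unit_interval R :=
  exist _ (tail_sum (set_val x)) (tail_weight_subproof x).

Lemma tail_weight_continuous : continuous tail_weight.
Proof.
apply: continuous_comp_initial.
suff : continuous (tail_sum \o set_val : simplex R m -> R) by [].
move=> x; apply: continuous_comp; first exact: initial_continuous.
apply: continuous_big => [|l _]; first exact: add_continuous.
exact: coord_continuous.
Qed.

End TailWeight.
Arguments tail_weight {R m} c x.

Lemma tail_weight0 (R : realType) m (x : simplex R m) :
  tail_weight 0 x = unit_interval1 R.
Proof.
apply: val_inj => /=; have [_ <-] : simplex R m (set_val x) by apply: set_valP.
exact: eq_bigl.
Qed.

Lemma tail_weight_gt (R : realType) m c (x : simplex R m) :
  (m < c)%N -> tail_weight c x = unit_interval0 R.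
Proof.
move=> mc; apply: val_inj => /=; apply: big_pred0 => l.
by apply/negbTE; rewrite -ltnNge (leq_trans (ltn_ord l)).
Qed.

(** Both sides are affine, so it is enough that they agree on vertices. *)
Lemma tail_weight_vertex_map (R : realType) m n c c'
    (phi : 'I_m.+1 -> 'I_n.+1) (x : simplex R m) :
  (forall l : 'I_m.+1, (c <= phi l)%N = (c' <= l)%N) ->
  tail_weight c (vertex_map R phi x) = tail_weight c' x.
Proof.
move=> cc'; apply: val_inj; rewrite /= /tail_sum/=.
rewrite [RHS](partition_big phi (fun k : 'I_n.+1 => c <= k)%N)/=; last first.
  by move=> l; rewrite cc'.
apply: eq_bigr => k ck; rewrite mxE; apply: eq_bigl => l.
by rewrite -cc'; case: eqVneq => [->|]; rewrite ?andbF// ck.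
Qed.

(** * The prism operator *)

Section Prism.
Variables (R : realType) (X Y : topologicalType).
Variable H : continuousType (X * unit_interval R)%type Y.

Section PrismSimplex.
Variables (m n : nat) (phi : 'I_m.+1 -> 'I_n.+1) (c : nat).
Variable s : singular_simplex R X n.

Definition prism (x : simplex R m) : Y :=
  H (s (vertex_map R phi x), tail_weight c x).

Lemma prism_continuous : continuous prism.
Proof.
move=> x; pose p y := (s (vertex_map R phi y), tail_weight c y).
have cp : {for x, continuous p}.
  apply: (@cvg_pair _ _ _ (nbhs x) (nbhs (s (vertex_map R phi x)))
    (nbhs (tail_weight c x))); last exact: tail_weight_continuous.
  exact: (@cts_fun _ _ (s \o vertex_map R phi)).
exact: continuous_comp cp (@cts_fun _ _ H _).
Qed.

HB.instance Definition _ :=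
  isContinuous.Build (simplex R m) Y prism prism_continuous.

Definition prism_simplex : singular_simplex R Y m := prism.

End PrismSimplex.

Lemma prism_eq m n (phi psi : 'I_m.+1 -> 'I_n.+1) c s :
  phi =1 psi -> prism_simplex phi c s = prism_simplex psi c s.
Proof. by move=> /funext ->. Qed.

(** The j-th face skips the vertex j, so that the threshold moves down by one
    exactly when j is below it. *)
Lemma prism_face m n (phi : 'I_m.+2 -> 'I_n.+1) c s (j : 'I_m.+2) :
  singular_face (prism_simplex phi c s) j =
  prism_simplex (phi \o lift j) (c - (j < c)) s.
Proof.
apply/continuousEP => x /=; rewrite /prism /= vertex_map_comp.
rewrite (@tail_weight_vertex_map _ _ _ _ (c - (j < c))) // => l /=.
by rewrite /bump; lia.
Qed.

Lemma prism_of_face m n (phi : 'I_m.+1 -> 'I_n.+1) c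
    (s : singular_simplex R X n.+1) (j : 'I_n.+2) :
  prism_simplex phi c (singular_face s j) = prism_simplex (lift j \o phi) c s.
Proof. by apply/continuousEP => x /=; rewrite /prism /= vertex_map_comp. Qed.

(** The degeneracy that identifies the vertices i and i + 1. *)
Definition codegen n (i : nat) (l : 'I_n.+2) : 'I_n.+1 := inord (unbump i l).

Definition prism_op_pos (n : nat) :
    {additive singular_chain R X n -> singular_chain R Y n.+1} :=
  fglift (fun s : singular_simplex R X n =>
    \sum_(i < n.+1) (-1) ^+ i *: << prism_simplex (codegen i) i.+1 s >>).

Lemma prism_op_posE (n : nat) (s : singular_simplex R X n) :
  prism_op_pos n << s >> =
  \sum_(i < n.+1) (-1) ^+ i *: << prism_simplex (codegen i) i.+1 s >>.
Proof. exact: fglift1. Qed.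

Definition prism_op (n : int) :
    {additive singular_complex R X n -> singular_complex R Y (1 + n)%R} :=
  match n with
  | Posz k => prism_op_pos k
  | Negz _ => \0
  end.

(** On the faces i and i + 1 of the i-th simplex of the prism, the degeneracy
    becomes the identity.  These faces are the slices with thresholds i and
    i + 1, and they occur with opposite signs; so summing over i telescopes. *)
Lemma bd_prism_op (n : nat) (s : singular_simplex R X n) :
  singular_bd_pos R Y n (prism_op_pos n << s >>) =
  << prism_simplex id 0 s >> - << prism_simplex id n.+1 s >> +
  \sum_(p : 'I_n.+1 * 'I_n.+2 | (p.2 != p.1 :> nat) && (p.2 != p.1.+1 :> nat))
    (-1) ^+ (p.1 + p.2) *:
      << singular_face (prism_simplex (codegen p.1) p.1.+1 s) p.2 >>.
Proof.
rewrite prism_op_posE raddf_sum/=.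
pose P c : {freeg (singular_simplex R Y n)} := << prism_simplex id c s >>.
pose t i (j : 'I_n.+2) : {freeg (singular_simplex R Y n)} := (-1) ^+ (i + j) *:
      << singular_face (prism_simplex (codegen i) i.+1 s) j >>.
transitivity (\sum_(i < n.+1) (P i - P i.+1 +
  \sum_(j < n.+2 | (j != i :> nat) && (j != i.+1 :> nat)) t i j)).
  apply: eq_bigr => i _; rewrite (raddfZsign (singular_bd_pos R Y n)).
  rewrite singular_bd_posE scaler_sumr.
  under eq_bigr do rewrite scalerA -exprD.
  (* Isolate the two faces on which the degeneracy is undone. *)
  rewrite (bigD1 (inord i))//= (bigD1 (inord i.+1))/=; last first.
    by rewrite -val_eqE /= !inordK//; have := ltn_ord i; lia.
  have id_codegen (k : nat) : (k == i \/ k == i.+1) ->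
      codegen i \o lift (inord k : 'I_n.+2) =1 id.
    move=> ki l; have := ltn_ord i; have /= := ltn_ord l => ln iN.
    have kn : (k < n.+2)%N by lia.
    apply: val_inj; rewrite /= /codegen/= (inordK kn) inordK /unbump /bump; lia.
  rewrite !prism_face (prism_eq _ _ (id_codegen i _)); last by left.
  rewrite (prism_eq _ _ (id_codegen i.+1 _)); last by right.
  have i1 := ltn_ord i.
  rewrite !inordK; [|lia|lia].
  (* The signs are (-1)^(2i) = 1 and (-1)^(2i+1) = -1. *)
  rewrite ltnSn ltnn subn1 subn0 /= addnn addnS addnn exprS.
  rewrite -signr_odd odd_double expr0 mulr1 scaleN1r scale1r addrA.
  congr (_ + _); apply: eq_bigl => j.
  by rewrite -!val_eqE /= !inordK//; lia.
rewrite big_split/= pair_big_dep /=; congr (_ + _).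
rewrite -(big_mkord xpredT (fun i => P i - P i.+1)) /=.
rewrite -[RHS]opprB -(telescope_sumr P)// -sumrN.
by apply: eq_bigr => i _; rewrite opprB.
Qed.

(** The pair (i, j), for the i-th simplex of the prism over the j-th face,
    is matched with a face of a simplex of the prism over s: with the face j of
    the simplex i + 1 if j <= i, and with the face j + 1 of the simplex i if
    j > i.  This reaches each face other than i and i + 1 of each simplex i
    once, and shifts i + j by one, whence the sign. *)
Lemma prism_op_bd (n : nat) (s : singular_simplex R X n.+1) :
  prism_op_pos n (singular_bd_pos R X n << s >>) =
  - \sum_(p : 'I_n.+2 * 'I_n.+3 | (p.2 != p.1 :> nat) && (p.2 != p.1.+1 :> nat))
    (-1) ^+ (p.1 + p.2) *:
      << singular_face (prism_simplex (codegen p.1) p.1.+1 s) p.2 >>.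
Proof.
rewrite singular_bd_posE raddf_sum/=.
transitivity (\sum_(j < n.+2) \sum_(i < n.+1)
   (-1) ^+ (i + j) *: << prism_simplex (lift j \o codegen i) i.+1 s >> :
   {freeg (singular_simplex R Y n.+1)}).
  apply: eq_bigr => j _; rewrite (raddfZsign (prism_op_pos n)).
  rewrite prism_op_posE scaler_sumr; apply: eq_bigr => i _.
  by rewrite scalerA -exprD prism_of_face addnC.
rewrite exchange_big pair_bigA/= -sumrN.
(* [bump] and [unbump] encode the case distinction between j <= i and j > i. *)
rewrite [RHS](reindex_onto
  (fun q : 'I_n.+1 * 'I_n.+2 => (inord (bump q.2 q.1), inord (bump q.1.+1 q.2)))
  (fun p : 'I_n.+2 * 'I_n.+3 =>
     (inord (unbump p.2 p.1), inord (unbump p.1.+1 p.2)))) /=;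
  last first.
  move=> [i j] /= ij; have := ltn_ord i; have := ltn_ord j => jn iN.
  by congr pair; apply: val_inj; rewrite /= !inordK /bump /unbump//; lia.
apply: eq_big => [[i j]/=|[i j]/= _].
  have := ltn_ord i; have := ltn_ord j => jn iN.
  rewrite xpair_eqE -!val_eqE /= !inordK /bump /unbump//; lia.
have := ltn_ord i; have := ltn_ord j => jn iN.
rewrite prism_face !inordK; [|rewrite /bump; lia..].
rewrite -scaleNr; congr (_ *: << _ >>).
  rewrite -signr_odd -[in RHS]signr_odd.
  have -> : odd (bump j i + bump i.+1 j) = ~~ odd (i + j) by rewrite /bump; lia.
  by case: odd; rewrite ?opprK.
have -> : ((bump j i).+1 - (bump i.+1 j < (bump j i).+1))%N = i.+1.
  by rewrite /bump; lia.
apply: prism_eq => l; apply: val_inj; have := ltn_ord l => ln.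
have jin : (bump i.+1 j < n.+3)%N by rewrite /bump; lia.
by rewrite /= /codegen/= (inordK jin) !inordK /bump /unbump; lia.
Qed.

End Prism.

(** The slices with thresholds 0 and n + 1 lie at times 1 and 0, so the
    telescoped sum is g s - f s; the remaining faces cancel against P (bd s). *)
Lemma prism_op_homotopy (R : realType) (X Y : topologicalType)
    (f g : continuousType X Y)
    (H : continuousType (X * unit_interval R)%type Y) :
  is_homotopy f g H ->
  is_chain_homotopy (singular_map R f) (singular_map R g) (prism_op H).
Proof.
move=> fHg.
have prism0 n (s : singular_simplex R X n) :
    prism_simplex H id 0 s = (g \o s : singular_simplex R Y n).
  apply/continuousEP => x /=; rewrite /prism /= tail_weight0.
  have [_ ->] := fHg (s (vertex_map R id x)).
  by congr (g (s _)); apply/val_inj/rowP => k; rewrite mxE big_pred1_eq.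
have prism1 n (s : singular_simplex R X n) :
    prism_simplex H id n.+1 s = (f \o s : singular_simplex R Y n).
  apply/continuousEP => x /=; rewrite /prism /= tail_weight_gt//.
  have [-> _] := fHg (s (vertex_map R id x)).
  by congr (f (s _)); apply/val_inj/rowP => k; rewrite mxE big_pred1_eq.
case=> [n|[|n]] x.
- pose l : {additive _ -> _} :=
    (singular_bd_pos R Y n.+1 \o prism_op_pos H n.+1) \+
    (prism_op_pos H n \o singular_bd_pos R X n).
  pose r : {additive _ -> _} :=
    singular_cmap_pos R g n.+1 \- singular_cmap_pos R f n.+1.
  suff : l =1 r by apply.
  apply: freeg_ext => s /=; rewrite bd_prism_op prism_op_bd addrK.
  by rewrite !singular_cmap_posE prism0 prism1.
(* In degree 0 the prism has only the faces that telescope, so no other term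
   is left to cancel. *)
- pose l : {additive _ -> _} := singular_bd_pos R Y 0 \o prism_op_pos H 0.
  pose r : {additive _ -> _} :=
    singular_cmap_pos R g 0 \- singular_cmap_pos R f 0.
  suff lr : l =1 r by rewrite /= addr0; exact: lr.
  apply: freeg_ext => s /=; rewrite bd_prism_op.
  rewrite !singular_cmap_posE prism0 prism1 big_pred0 ?addr0//.
  by case=> i j /=; have := ltn_ord i; have := ltn_ord j; lia.
(* In negative degrees the target is the zero group. *)
- exact: etrans (thinmx0 _) (esym (thinmx0 _)).
Qed.

Lemma prism_op_natural (R : realType) (X X' Y Y' : topologicalType)
    (u : continuousType X X') (v : continuousType Y Y')
    (H : continuousType (X * unit_interval R)%type Y)
    (H' : continuousType (X' * unit_interval R)%type Y') :
  (forall x t, v (H (x, t)) = H' (u x, t)) ->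
  forall n (x : singular_complex R X n),
    singular_map R v (1 + n) (prism_op H n x) =
    prism_op H' n (singular_map R u n x).
Proof.
move=> vH; case=> [n|n] x; last exact: raddf0.
pose l : {additive _ -> _} := singular_cmap_pos R v n.+1 \o prism_op_pos H n.
pose r : {additive _ -> _} := prism_op_pos H' n \o singular_cmap_pos R u n.
suff : l =1 r by apply.
apply: freeg_ext => s /=; rewrite singular_cmap_posE !prism_op_posE raddf_sum.
apply: eq_bigr => i _; rewrite (raddfZsign (singular_cmap_pos R v n.+1)).
rewrite singular_cmap_posE; congr (_ *: << _ >>).
by apply/continuousEP => y; exact: vH.
Qed.

(** * Chain homotopies and homology of the limit *)

Section LimitHomotopy.
Variables (Q : quiver) (A B : chainRep Q).
Variable F : forall i n, {additive A i n -> B i (1 + n)%R}.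
Hypothesis F_natural : forall i j (al : arrow i j) n (x : A i n),
  carrow B al (1 + n) (F i n x) = F j n (carrow A al n x).

Fact limit_homotopy_subproof n (x : limit_chain A n) :
  (fun i => F i n (limit_val x i)) \in compatible B (1 + n).
Proof.
apply/asboolP => i j a; rewrite F_natural; congr (F j n _).
by have /asboolP := limit_valP x; apply.
Qed.

Definition limit_homotopy_fun n (x : limit A n) : limit B (1 + n) :=
  LimitChain (limit_homotopy_subproof x).

Fact limit_homotopy_is_zmod_morphism n : zmod_morphism (@limit_homotopy_fun n).
Proof.
move=> x y; apply/val_inj/functional_extensionality_dep => i.
exact: raddfB.
Qed.

HB.instance Definition _ n := GRing.isZmodMorphism.Build
  (limit A n) (limit B (1 + n)) (@limit_homotopy_fun n)
  (@limit_homotopy_is_zmod_morphism n).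

Lemma limit_chain_homotopy (a b : chainRepHom A B) :
  (forall i, is_chain_homotopy (chom a i) (chom b i) (F i)) ->
  is_chain_homotopy (limit_map a) (limit_map b)
    (fun n => @limit_homotopy_fun n).
Proof.
move=> aFb n x; apply/val_inj/functional_extensionality_dep => i.
exact: aFb.
Qed.

End LimitHomotopy.

(** The homotopy equation is only given in degrees of the form 1 + m, whereas
    cycles are in an arbitrary degree n; every integer has this form. *)
Lemma chain_homotopy_cycle (A B : chainComplex) (a b : chainMap A B)
    (F : forall n, {additive A n -> B (1 + n)%R}) :
  is_chain_homotopy a b F ->
  forall n (z : A n), bd_from z = 0 -> bd B n (F n z) = b n z - a n z.
Proof.
move=> aFb n; have [m ->] : exists m, n = 1 + m.
  by exists (n - 1); rewrite addrC subrK.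
move=> z /eqP; rewrite bd_from1 => /eqP z0.
by rewrite -aFb z0 raddf0 addr0.
Qed.

Lemma chain_homotopy_homology (A B : chainComplex) (a b : chainMap A B)
    (F : forall n, {additive A n -> B (1 + n)%R}) :
  is_chain_homotopy a b F -> forall n, homology_map a n =1 homology_map b n.
Proof.
move=> aFb n; elim/quotW => z; rewrite !homology_map_pi; apply/esym/eqP.
rewrite -Quotient.idealrBE; apply/asboolP; exists (F n (cycle_val z)).
by rewrite (chain_homotopy_cycle aFb)//; exact/eqP/cycle_valP.
Qed.

Theorem theorem5p5 (R : realType) (Q : quiver) (T T' : topRep Q)
    (mu nu : topRepHom T T') :
  top_homotopic R mu nu ->
  chain_homotopic (singular_rep_hom R mu) (singular_rep_hom R nu) /\
  forall n : nat, quiver_homology_map R n mu = quiver_homology_map R n nu.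
Proof.
move=> [H [muHnu H_natural]].
have homotopicS :
    chain_homotopic (singular_rep_hom R mu) (singular_rep_hom R nu).
  exists (fun i => prism_op (H i)); split=> [i|i j al n x].
    exact: prism_op_homotopy.
  by apply: prism_op_natural; exact: H_natural.
split=> // n; apply: additive_ext; have [F [muFnu F_natural]] := homotopicS.
exact: chain_homotopy_homology (limit_chain_homotopy F_natural muFnu) n.
Qed.
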